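(* Let $t_0 \in \mathbb{R}$, let $c$ be a positive constant, and let $u(t)$, $v(t)$ and $f(t)$ be real-valued continuous functions on $[t_0,+\infty)$ such that for all $t \ge t_0$ $$u(t) \ge 0, \qquad v(t) \ge 0, \qquad \int_{t_0}^{t} f(\zeta)\, d\zeta \ge 0,$$ $$u(t) \le c + \int_{t_0}^{t} v(\zeta) u(\zeta)\, d\zeta + \int_{t_0}^{t} f(\zeta)\, d\zeta .$$ Then $$u(t) \le c \exp\left\{\int_{t_0}^{t} v(\zeta)\, d\zeta\right\} + \int_{t_0}^{t} \exp\left\{\int_{\zeta}^{t} v(s)\, ds\right\} f(\zeta)\, d\zeta \qquad \text{for all } t \ge t_0 .$$
   Context: All functions are real-valued functions of a real variable; the function $f$ itself is not assumed to be nonnegative, only its integral from $t_0$ to $t$ is, for every $t \ge t_0$. *)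

(* Defs.v *)
From Stdlib Require Import Reals.
From Coquelicot Require Import Coquelicot.

(* Main.v *)
(** Let [W] be the right-hand side of the assumed inequality and [V] the
    primitive of [v] vanishing at [t0]. Since [u <= W] and [v >= 0], we have
    [W' = v u + f <= v W + f], so [(W exp (- V))' <= f exp (- V)]; integrate from
    [t0] and multiply by [exp V]. Continuity at [t0] is only one-sided, so the
    functions are first extended by constants to the left of [t0]. *)
Require Import Defs.
From Stdlib Require Import Reals Lra.
From Coquelicot Require Import Coquelicot.
Open Scope R_scope.

Lemma ex_RInt_continuous_everywhere (f : R -> R) (a b : R) :
  (forall x, continuous f x) -> ex_RInt f a b.
Proof. intros Hf; apply (@ex_RInt_continuous R_CompleteNormedModule); auto. Qed.

Lemma is_derive_RInt_continuous (f : R -> R) (a x : R) :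
  (forall y, continuous f y) -> is_derive (RInt f a) x (f x).
Proof.
  intros Hf; apply (is_derive_RInt f _ a x); [|apply Hf].
  apply filter_forall; intros b.
  apply (@RInt_correct R_CompleteNormedModule).
  now apply ex_RInt_continuous_everywhere.
Qed.

(** By the mean value theorem, [h b - h a] equals [dh x * (b - a)] for some [x] in [[a, b]]. The
    sign of [dh] is only asked for to the right of [a], which is where the sign of [v] and the bound
    on [u] will be available. *)
Lemma is_derive_nonneg_le (h dh : R -> R) (a b : R) :
  (forall x, is_derive h x (dh x)) ->
  (forall x, a <= x -> 0 <= dh x) -> a <= b -> h a <= h b.
Proof.
  intros Hd Hpos Hab.
  destruct (MVT_gen h a b dh) as [x [Hx Heq]].
  - intros x _; apply Hd.
  - intros x _; apply derivable_continuous_pt.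
    exists (dh x); apply is_derive_Reals, Hd.
  - rewrite Rmin_left in Hx by exact Hab.
    assert (0 <= dh x * (b - a)) by (apply Rmult_le_pos; [apply Hpos|]; lra).
    lra.
Qed.

(** The map [Rmax a] is 1-Lipschitz with values in the half-line from [a], so it carries
    neighbourhoods of [x] to neighbourhoods of [Rmax a x] within that half-line, where one-sided
    continuity of [f] is enough. *)
Lemma continuous_extend_left (f : R -> R) (a : R) :
  continuous_on (fun t => a <= t) f ->
  forall x, continuous (fun t => f (Rmax a t)) x.
Proof.
  intros Hf x.
  apply filterlim_comp with (within (fun t => a <= t) (locally (Rmax a x))).
  2: exact (Hf _ (Rmax_l a x)).
  intros P [eps Heps]; exists eps; intros y Hy.
  apply Heps; [|apply Rmax_l].
  change (Rabs (Rmax a y - Rmax a x) < eps).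
  change (Rabs (y - x) < eps) in Hy.
  apply Rle_lt_trans with (2 := Hy).
  unfold Rmax; repeat destruct Rle_dec; unfold Rabs; repeat destruct Rcase_abs; lra.
Qed.

(** The lower limit [a] is kept apart from [t0] because the integral in the exponent starts at an
    intermediate point [z]. *)
Lemma RInt_extend_left (f g : R -> R) (t0 a b : R) :
  (forall x, t0 <= x -> f x = g x) -> t0 <= a -> a <= b ->
  RInt f a b = RInt g a b.
Proof.
  intros H Ha Hab; apply (@RInt_ext R_CompleteNormedModule); intros x Hx.
  rewrite Rmin_left in Hx by exact Hab; apply H; lra.
Qed.

(** Continuity on the whole line makes every primitive differentiable in the two-sided sense, also
    at [t0]. The inequalities stay restricted to the half-line, since monotonicity is only used from
    [t0] on. *)
Lemma gronwall_continuous (t0 c : R) (u v f : R -> R)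
  (u_cont : forall x, continuous u x)
  (v_cont : forall x, continuous v x)
  (f_cont : forall x, continuous f x)
  (v_ge0 : forall t, t0 <= t -> 0 <= v t)
  (u_le : forall t, t0 <= t ->
     u t <= c + RInt (fun z => v z * u z) t0 t + RInt f t0 t) :
  forall t, t0 <= t ->
    u t <= c * exp (RInt v t0 t)
           + RInt (fun z => exp (RInt v z t) * f z) t0 t.
Proof.
  intros t Ht.
  set (V := RInt v t0).
  set (A := RInt (fun z => v z * u z) t0).
  set (F := RInt f t0).
  set (g := fun z => exp (- V z) * f z).
  set (G := RInt g t0).
  assert (dV : forall x, is_derive V x (v x))
    by (intros; now apply is_derive_RInt_continuous).
  assert (dA : forall x, is_derive A x (v x * u x)).
  { intros x; apply (is_derive_RInt_continuous (fun z => v z * u z)); intros y.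
    now apply (continuous_mult v u). }
  assert (dF : forall x, is_derive F x (f x))
    by (intros; now apply is_derive_RInt_continuous).
  assert (g_cont : forall x, continuous g x).
  { intros x; apply (continuous_mult (fun z => exp (- V z)) f); [|apply f_cont].
    apply (@ex_derive_continuous R_AbsRing R_NormedModule); auto_derive.
    now exists (v x). }
  assert (dG : forall x, is_derive G x (g x))
    by (intros; now apply is_derive_RInt_continuous).
  assert (point : forall h : R -> R, RInt h t0 t0 = 0)
    by (intros h; apply (RInt_point t0 h)).
  assert (key : 0 <= c + G t - (c + A t + F t) * exp (- V t)).
  (* The function to be shown nondecreasing starts at zero: at [t0] all primitives vanish and only
     [c - c * exp 0] is left. *)
  { replace 0 with (c + G t0 - (c + A t0 + F t0) * exp (- V t0)).
    2: unfold G, A, F, V; rewrite !point, Ropp_0, exp_0; ring.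
    apply is_derive_nonneg_le with
      (h := fun x => c + G x - (c + A x + F x) * exp (- V x))
      (* In the derivative the two terms [f x * exp (- V x)] cancel; what remains is [v] times the
         slack in the bound on [u]. *)
      (dh := fun x => v x * (c + A x + F x - u x) * exp (- V x)); [| |exact Ht].
    - intros x; auto_derive.
      + repeat split; eexists; eauto.
      + rewrite (is_derive_unique (fun y : R => G y) _ _ (dG x)),
          (is_derive_unique (fun y : R => A y) _ _ (dA x)),
          (is_derive_unique (fun y : R => F y) _ _ (dF x)),
          (is_derive_unique (fun y : R => V y) _ _ (dV x)).
        unfold g; ring.
    - intros x Hx; apply Rmult_le_pos; [|left; apply exp_pos].
      apply Rmult_le_pos; [now apply v_ge0|].
      specialize (u_le x Hx); fold (A x) (F x) in u_le; lra. }
  (* Chasles' relation turns the exponent into [V t - V z], so the factor [exp (V t)] leaves the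
     integral. *)
  assert (HG : RInt (fun z => exp (RInt v z t) * f z) t0 t = exp (V t) * G t).
  { rewrite (@RInt_ext R_CompleteNormedModule _ (fun z => scal (exp (V t)) (g z))).
    - apply (@RInt_scal R_CompleteNormedModule).
      now apply ex_RInt_continuous_everywhere.
    - intros z _; change (exp (RInt v z t) * f z = exp (V t) * (exp (- V z) * f z)).
      rewrite <- Rmult_assoc, <- exp_plus; do 2 f_equal.
      assert (HC : V z + RInt v z t = V t).
      { apply (@RInt_Chasles R_CompleteNormedModule);
          now apply ex_RInt_continuous_everywhere. }
      lra. }
  rewrite HG; fold (V t).
  apply Rle_trans with (1 := u_le t Ht); fold (A t) (F t).
  assert (E : exp (V t) * exp (- V t) = 1)
    by (rewrite <- exp_plus, Rplus_opp_r; apply exp_0).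
  (* Multiplying [key] by [exp (V t)] undoes the integrating factor; inserting the product [E] lets
     both sides match as linear expressions in the same monomials. *)
  apply (Rmult_le_pos (exp (V t))) in key; [|left; apply exp_pos].
  replace (c + A t + F t) with ((c + A t + F t) * (exp (V t) * exp (- V t)))
    by (rewrite E; ring).
  lra.
Qed.

Theorem lemma2 (t0 c : R) (u v f : R -> R)
  (c_pos : 0 < c)
  (u_cont : continuous_on (fun t => t0 <= t) u)
  (v_cont : continuous_on (fun t => t0 <= t) v)
  (f_cont : continuous_on (fun t => t0 <= t) f)
  (u_ge0 : forall t, t0 <= t -> 0 <= u t)
  (v_ge0 : forall t, t0 <= t -> 0 <= v t)
  (int_f_ge0 : forall t, t0 <= t -> 0 <= RInt f t0 t)
  (u_le : forall t, t0 <= t ->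
     u t <= c + RInt (fun z => v z * u z) t0 t + RInt f t0 t) :
  forall t, t0 <= t ->
    u t <= c * exp (RInt v t0 t)
           + RInt (fun z => exp (RInt v z t) * f z) t0 t.
Proof.
  set (ext := fun (h : R -> R) t => h (Rmax t0 t)).
  assert (extE : forall h t, t0 <= t -> ext h t = h t)
    by (intros h t Ht; unfold ext; now rewrite Rmax_right).
  intros t Ht.
  (* The conclusion only involves values at points from [t0] on, where each function equals its
     extension, so it may be restated for the extensions. *)
  rewrite <- (extE u t Ht).
  rewrite <- (RInt_extend_left (ext v) v t0 t0 t (extE v) (Rle_refl t0) Ht).
  rewrite <- (@RInt_ext R_CompleteNormedModule
                (fun z => exp (RInt (ext v) z t) * ext f z)
                (fun z => exp (RInt v z t) * f z)).
  - apply gronwall_continuous; try (now apply continuous_extend_left); [| |exact Ht].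
    + intros s Hs; rewrite extE by exact Hs; now apply v_ge0.
    + intros s Hs; rewrite extE by exact Hs.
      rewrite (RInt_extend_left (ext f) f t0) by (auto using Rle_refl).
      rewrite (RInt_extend_left _ (fun z => v z * u z) t0);
        [now apply u_le| |apply Rle_refl|exact Hs].
      intros x Hx; now rewrite !extE.
  (* Here [z] lies strictly between [t0] and [t], so the inner integral from [z] to [t] does not see
     the extended part. *)
  - intros z Hz; rewrite Rmin_left, Rmax_right in Hz by exact Ht.
    rewrite extE by lra.
    rewrite (RInt_extend_left (ext v) v t0); auto; lra.
Qed.
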